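(* Let $(X,Y,\langle\cdot,\cdot\rangle)$ be an asymmetric dual pair. Then the Mackey topology $\tau(X,Y)$ is the finest $T_0$ asymmetric locally convex topology on $X$ with dual space $Y$.
   Context: All vector spaces and cones are over the reals; a cone is a commutative monoid $(Y,+,0)$ with a scalar multiplication by nonnegative reals satisfying the usual vector space axioms. An asymmetric dual pair $(X,Y,\langle\cdot,\cdot\rangle)$ consists of a vector space $X$, a cone $Y$ and a map $\langle\cdot,\cdot\rangle:X\times Y\to\mathbb R$ that is bilinear (with respect to nonnegative scalars in the second variable) and nondegenerate: $\langle x,\cdot\rangle=0$ implies $x=0$, and $\langle\cdot,y\rangle=\langle\cdot,z\rangle$ implies $y=z$. An asymmetric seminorm on a vector space $X$ is a function $p:X\to[0,\infty)$ with $p(rx)=rp(x)$ for $r\ge 0$ and $p(x+y)\le p(x)+p(y)$. A family $\mathcal P$ of asymmetric seminorms on $X$ induces the topology with basis the sets $\{y\in X: p(y-x)<\epsilon\ \forall p\in F\}$, for $x\in X$, $\epsilon>0$, $F\subseteq\mathcal P$ finite. A topology on $X$ arising this way is an asymmetric locally convex topology. The dual space $(X,\alpha)^*$ of $X$ with such a topology $\alpha$ is the cone of all linear, $\alpha$-upper semicontinuous functions $X\to\mathbb R$. ''With dual space $Y$'' means $(X,\alpha)^*=\{\langle\cdot,y\rangle:y\in Y\}$, where $y\in Y$ is identified with $\langle\cdot,y\rangle$. $\sigma(Y,X)$ is the topology on $Y$ of pointwise convergence on $X$: $y_\alpha\to y$ iff $\langle x,y_\alpha\rangle\to\langle x,y\rangle$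 for all $x\in X$. The Mackey topology $\tau(X,Y)$ on $X$ is the topology induced by the asymmetric seminorms $p_B(x)=\sup_{y\in B}\max\{\langle x,y\rangle,0\}$, where $B$ runs over all convex, $\sigma(Y,X)$-compact subsets of $Y$. *)

(* Defs.v *)
From HB Require Import structures.
From mathcomp Require Import all_boot all_order all_algebra.
From mathcomp Require Import all_classical all_reals all_analysis.
Set Implicit Arguments.
Unset Strict Implicit.
Unset Printing Implicit Defensive.
Import Order.TTheory GRing.Theory Num.Theory.
Import numFieldNormedType.Exports.
Local Open Scope classical_set_scope.
Local Open Scope ring_scope.

(* A cone in the sense of a module over the semiring [0, +oo[ is an
   [lSemiModType (nnreal R)]. *)
Record nnreal (R : numDomainType) := NNReal {
  nnreal_val : R;
  _ : nnreal_val \is Num.nneg }.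

HB.instance Definition _ (R : numDomainType) :=
  [isSub for @nnreal_val R].
HB.instance Definition _ (R : numDomainType) := [Choice of nnreal R by <:].
HB.instance Definition _ (R : numDomainType) :=
  [SubChoice_isSubComNzSemiRing of nnreal R by <:].

Section AsymmetricSeminorm.
Context {R : realType} {X : lmodType R}.

Record asym_seminorm := AsymSeminorm {
  asn_fun :> X -> R;
  asn_ge0 : forall x, 0 <= asn_fun x;
  asn_hom : forall (r : R) x, 0 <= r -> asn_fun (r *: x) = r * asn_fun x;
  asn_add : forall x y, asn_fun (x + y) <= asn_fun x + asn_fun y }.

Definition asym_ball (F : set asym_seminorm) (x : X) (e : R) : set X :=
  [set y | forall p, F p -> p (y - x) < e].

Definition asym_basis (P : set asym_seminorm) : set (set X) :=
  [set U | exists F x e, [/\ finite_set F, F `<=` P, 0 < e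
                           & U = asym_ball F x e]].

Lemma asym_ball_center (F : set asym_seminorm) (x : X) (e : R) :
  0 < e -> asym_ball F x e x.
Proof. by move=> e0 p _; rewrite subrr -(scale0r 0) asn_hom// mul0r. Qed.

Lemma asym_basis_cover (P : set asym_seminorm) :
  \bigcup_(U in asym_basis P) U = setT.
Proof.
apply/seteqP; split=> // x _.
exists (asym_ball set0 x 1); last exact: asym_ball_center.
by exists set0, x, 1; split=> //; exact: ltr01.
Qed.

Lemma asym_ball_inner (F : set asym_seminorm) (x t : X) (e : R) :
    finite_set F -> 0 < e -> asym_ball F x e t ->
  exists2 d, 0 < d & asym_ball F t d `<=` asym_ball F x e.
Proof.
move=> finF e0 xt.
have /finite_seqP[s sE] : finite_set [set p (t - x) | p in F].
  exact: finite_image.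
have slt r : r \in s -> r < e.
  move=> rs; have : [set p (t - x) | p in F] r by rewrite sE.
  by case=> p Fp <-; exact: xt.
have [d d0 ds] : exists2 d, 0 < d & forall r, r \in s -> r + d <= e.
  elim: s slt {sE} => [_|r s ih slt]; first by exists 1.
  have [|d d0 ds] := ih; first by move=> q qs; apply: slt; rewrite inE qs orbT.
  exists (Num.min d (e - r)).
    by rewrite lt_min d0 subr_gt0 slt// mem_head.
  move=> q; rewrite inE => /predU1P[->|qs].
    by rewrite -lerBrDl ge_min lexx orbT.
  by rewrite (le_trans _ (ds q qs))// lerD2l ge_min lexx.
exists d => // z tz p Fp.
have -> : z - x = (z - t) + (t - x) by rewrite addrA subrK.
have ps : p (t - x) \in s.
  by have : [set` s] (p (t - x)) by rewrite -sE; exists p.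
apply: le_lt_trans (asn_add _ _ _) _.
by rewrite (lt_le_trans _ (ds _ ps))// addrC ltrD2l tz.
Qed.

Lemma asym_basis_join (P : set asym_seminorm) (U V : set X) (t : X) :
    asym_basis P U -> asym_basis P V -> U t -> V t ->
  exists W, [/\ asym_basis P W, W t & W `<=` U `&` V].
Proof.
move=> [F [x [e [finF FP e0 ->]]]] [G [y [f [finG GP f0 ->]]]] xt yt.
have [d d0 dF] := asym_ball_inner finF e0 xt.
have [c c0 cG] := asym_ball_inner finG f0 yt.
exists (asym_ball (F `|` G) t (Num.min d c)); split.
- exists (F `|` G), t, (Num.min d c); split=> //.
  + by rewrite finite_setU.
  + by move=> p [/FP|/GP].
  + by rewrite lt_min d0 c0.
- by apply: asym_ball_center; rewrite lt_min d0 c0.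
- move=> z tz; split.
  + by apply: dF => p Fp; have := tz p (or_introl Fp); rewrite lt_min => /andP[].
  + by apply: cG => p Gp; have := tz p (or_intror Gp); rewrite lt_min => /andP[].
Qed.

Definition asym_space (P : set asym_seminorm) : Type := X.

Section Instances.
Variable P : set asym_seminorm.
HB.instance Definition _ := Choice.on (asym_space P).
HB.instance Definition _ := isBaseTopological.Build (asym_space P)
  (asym_basis_cover P) (@asym_basis_join P).
End Instances.

Definition asym_topology (P : set asym_seminorm) : Topological X :=
  Topological.on (asym_space P).

End AsymmetricSeminorm.
Arguments asym_seminorm {R} X.

(* As in sup_topology, a topology on X is a value of the class [Topological X];
   the choice structure it carries along plays no role below. *)
Section Topologies.
Context {R : realType} {X : lmodType R}.
Implicit Types alpha beta : Topological X.

Definition opens alpha : set (set X) := @open (Topological.Pack alpha).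

Definition T0_topology alpha : Prop :=
  kolmogorov_space (Topological.Pack alpha).

Definition asym_locally_convex alpha : Prop :=
  exists P : set (asym_seminorm X), opens alpha = opens (asym_topology P).

Definition upper_semicontinuous alpha (f : X -> R) : Prop :=
  forall a : R, opens alpha [set x | f x < a].

Definition dual_space alpha : set (X -> R) :=
  [set f | scalar f /\ upper_semicontinuous alpha f].

Definition finest (C : set (Topological X)) alpha : Prop :=
  C alpha /\ forall beta, C beta -> opens beta `<=` opens alpha.

End Topologies.

Section DualPair.
Context {R : realType} {X : lmodType R} {Y : lSemiModType (nnreal R)}.

Record asym_dual_pair (B : X -> Y -> R) : Prop := AsymDualPair {
  pair_linearl : forall y, scalar (B^~ y);
  pair_addr : forall x, {morph B x : y z / y + z};
  pair_scaler : forall x (r : nnreal R) y, B x (r *: y) = val r * B x y;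
  pair_nondegl : forall x, (forall y, B x y = 0) -> x = 0;
  pair_nondegr : forall y z, (forall x, B x y = B x z) -> y = z }.

Variable B : X -> Y -> R.

(* sigma(Y, X) *)
Definition dual_topology : Type :=
  initial_topology (fun y : Y => B^~ y : {ptws X -> R}).
HB.instance Definition _ := Topological.on dual_topology.

Definition cone_convex (K : set Y) : Prop :=
  forall (s t : nnreal R) y z, val s + val t = 1 -> K y -> K z ->
    K (s *: y + t *: z).

(* For K empty this is 0, since [sup set0 = 0]. *)
Definition support_function (K : set Y) (x : X) : R :=
  sup [set Num.max (B x y) 0 | y in K].

Definition mackey_seminorms : set (asym_seminorm X) :=
  [set p | exists K : set Y, [/\ cone_convex K,
     compact (K : set dual_topology) & p = support_function K :> (X -> R)]].

Definition mackey_topology : Topological X := asym_topology mackey_seminorms.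

Definition has_dual (alpha : Topological X) : Prop :=
  dual_space alpha = range (fun y : Y => B^~ y).

Lemma pair_continuous (x : X) : continuous (B x : dual_topology -> R).
Proof.
move=> y.
apply: (@continuous_comp dual_topology {ptws X -> R} R (fun y => B^~ y)
  (fun f => f x)).
  exact: initial_continuous.
exact: proj_continuous.
Qed.

Lemma pair_bounded (K : set Y) (x : X) : compact (K : set dual_topology) ->
  exists M, forall y, K y -> B x y <= M.
Proof.
move=> cK.
have : compact ((B x : dual_topology -> R) @` K).
  apply: (@continuous_compact dual_topology R (B x)) => //.
  exact/continuous_subspaceT/pair_continuous.
move=> /compact_bounded [M [_ bM]].
exists (M + 1) => y Ky; apply: le_trans (ler_norm _) _.
by apply: (bM (M + 1)); rewrite ?ltrDl//; exists y.
Qed.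

(* No K is left out of [mackey_seminorms]: for K compact the support function
   is finite, and it is an asymmetric seminorm. *)
Lemma support_function_seminorm (K : set Y) :
    asym_dual_pair B -> compact (K : set dual_topology) ->
  exists p : asym_seminorm X, p = support_function K :> (X -> R).
Proof.
move=> dB cK; have [->|/set0P[y0 Ky0]] := eqVneq K set0.
  have E : support_function set0 = (fun=> 0).
    by apply/funext => x; rewrite /support_function image_set0 sup0.
  have h0 (x : X) : 0 <= (fun=> 0 : R) x by [].
  have h1 (r : R) (x : X) : 0 <= r -> (0 : R) = r * 0 by rewrite mulr0.
  have h2 (x y : X) : (0 : R) <= 0 + 0 by rewrite addr0.
  by exists (@AsymSeminorm _ _ (fun=> 0) h0 h1 h2).
have ub x : has_ubound [set Num.max (B x y) 0 | y in K].
  have [M KM] := pair_bounded x cK.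
  exists (Num.max M 0) => _ [y Ky <-].
  by rewrite ge_max !le_max KM// lexx orbT.
have le_sf x y : K y -> Num.max (B x y) 0 <= support_function K x.
  by move=> Ky; apply: ub_le_sup => //; exists y.
have sf_le x M : (forall y, K y -> Num.max (B x y) 0 <= M) ->
    support_function K x <= M.
  move=> KM; apply: ge_sup; first by exists (Num.max (B x y0) 0), y0.
  by move=> _ [y Ky <-]; exact: KM.
have BD x z y : B (x + z) y = B x y + B z y.
  by have := pair_linearl dB y 1 x z; rewrite scale1r mul1r.
have B0 y : B 0 y = 0.
  by apply: (addrI (B 0 y)); rewrite -BD !addr0.
have BZ r x y : B (r *: x) y = r * B x y.
  by have := pair_linearl dB y r x 0; rewrite B0 !addr0.
have sf_ge0 x : 0 <= support_function K x.
  by apply: le_trans (le_sf x _ Ky0); rewrite le_max lexx orbT.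
have sfZ_le (r : R) x : 0 <= r -> support_function K (r *: x) <= r * support_function K x.
  move=> r0; apply: sf_le => y Ky.
  by rewrite BZ -[X in Num.max _ X](mulr0 r) -maxr_pMr// ler_wpM2l// le_sf.
have sfZ (r : R) x : 0 <= r -> support_function K (r *: x) = r * support_function K x.
  rewrite le_eqVlt => /predU1P[<-|r0].
    apply/le_anti; rewrite sfZ_le//= mul0r; exact: sf_ge0.
  apply/eqP; rewrite eq_le sfZ_le ?(ltW r0)//= -ler_pdivlMl//.
  have := @sfZ_le r^-1 (r *: x); rewrite scalerK ?lt0r_neq0//; apply.
  by rewrite invr_ge0 (ltW r0).
have sfD x z : support_function K (x + z) <=
    support_function K x + support_function K z.
  apply: sf_le => y Ky; rewrite BD ge_max addr_ge0// andbT lerD//.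
    by apply: le_trans (le_sf _ _ Ky); rewrite le_max lexx.
  by apply: le_trans (le_sf _ _ Ky); rewrite le_max lexx.
by exists (AsymSeminorm sf_ge0 sfZ sfD).
Qed.

End DualPair.

(* Main.v *)
Require Import Defs.
From HB Require Import structures.
From mathcomp Require Import all_boot all_order all_algebra.
From mathcomp Require Import all_classical all_reals all_analysis.
From mathcomp Require Import lra.
Set Implicit Arguments.
Unset Strict Implicit.
Unset Printing Implicit Defensive.
Import Order.TTheory GRing.Theory Num.Theory.
Import numFieldNormedType.Exports.
Local Open Scope classical_set_scope.
Local Open Scope ring_scope.

(** A seminorm on [X] dominates no linear functional outside [Y] exactly when it
    is the support function of a weakly compact convex subset of [Y]. Each half
    of the theorem rests on one direction of this equivalence.

    The dual of the Mackey topology is [Y]. Each [B^~ y] is upper semicontinuous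
    because the singleton [[set y]] is convex and compact; these functionals
    separate points, whence T0. Conversely, let [f] be linear and upper
    semicontinuous. A basic ball inside [[set x | f x < 1]] involves finitely
    many compact convex sets, which lie with [0] in one compact convex [L]
    ([convex_hull_seq]), and a multiple of [f] is then dominated by the support
    function of [L]. Such an [f] is represented by a point of [L]
    ([dominated_representable]). This is the separation theorem for the weak
    topology. Compactness of [L] reduces it to finitely many points of [X], where
    a point of [L] at least distance from an orthant does the separation
    ([finite_domination]).

    The Mackey topology is finest. Suppose that a family [P] of seminorms
    induces a topology with dual [Y] and let [p] be in [P]. The linear functionals below [p] are upper
    semicontinuous, hence are given by points of [Y]. They form a convex set
    [polar p], weakly compact by Tychonoff's theorem ([polar_compact]), and [p]
    is its support function by the Hahn-Banach theorem ([hahn_banach]). So [p] is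
    one of the seminorms that define the Mackey topology. *)

(** * Dominated linear extension *)

Section HahnBanach.
Context {R : realType} {X : lmodType R}.
Implicit Types (p q : X -> R) (x y z : X) (r : R) (Phi : set (X -> R)).

Definition sublinear q : Prop :=
  (forall (r : R) x, 0 <= r -> q (r *: x) <= r * q x) /\
  (forall x y, q (x + y) <= q x + q y).

Lemma sublinear_ge0 q : sublinear q -> 0 <= q 0.
Proof. by move=> [_ qD]; have := qD 0 0; rewrite addr0; lra. Qed.

Lemma sublinearZ q r x : sublinear q -> 0 <= r -> q (r *: x) = r * q x.
Proof.
move=> sq; have [qZ _] := sq; rewrite le_eqVlt => /predU1P[<-|r0].
  apply/le_anti; rewrite qZ//= mul0r scale0r; exact: sublinear_ge0.
apply/le_anti; rewrite qZ ?(ltW r0)//= -ler_pdivlMl//.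
by apply: le_trans (qZ _ _ _); rewrite ?scalerK ?gt_eqF// invr_ge0 (ltW r0).
Qed.

Lemma sublinear_lower q x : sublinear q -> - q (- x) <= q x.
Proof.
move=> sq; have := sublinear_ge0 sq; have := sq.2 x (- x).
by rewrite subrr; lra.
Qed.

Definition inf_fun Phi (x : X) : R := inf [set phi x | phi in Phi].

Section Infimum.
Variables (Phi : set (X -> R)) (low : X -> R).
Hypothesis Phi0 : Phi !=set0.
Hypothesis Phi_low : forall phi x, Phi phi -> low x <= phi x.

Lemma inf_fun_le phi x : Phi phi -> inf_fun Phi x <= phi x.
Proof.
move=> Pphi; apply: ge_inf; last by exists phi.
by exists (low x) => _ [psi Ppsi <-]; exact: Phi_low.
Qed.

Lemma le_inf_fun m x : (forall phi, Phi phi -> m <= phi x) ->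
  m <= inf_fun Phi x.
Proof.
move=> mPhi; apply: lb_le_inf; last by move=> _ [phi Pphi <-]; exact: mPhi.
by have [phi Pphi] := Phi0; exists (phi x), phi.
Qed.

(** The two inequalities of sublinearity need only hold across the family, not
    for each of its members: this covers both the chains in Zorn's lemma and
    [slope_family] below, whose members need not be sublinear. *)
Lemma inf_fun_sublinear :
  (forall phi (r : R) x, Phi phi -> 0 <= r ->
     exists2 chi, Phi chi & chi (r *: x) <= r * phi x) ->
  (forall phi psi x z, Phi phi -> Phi psi ->
     exists2 chi, Phi chi & chi (x + z) <= phi x + psi z) ->
  sublinear (inf_fun Phi).
Proof.
move=> PhiZ PhiD; split=> [r x|x z].
  have le r' x' : 0 < r' -> inf_fun Phi (r' *: x') <= r' * inf_fun Phi x'.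
    move=> r0; rewrite -ler_pdivrMl//; apply: le_inf_fun => phi Pphi.
    have [chi Pchi le_chi] := PhiZ _ _ x' Pphi (ltW r0).
    by rewrite ler_pdivrMl//; exact: le_trans (inf_fun_le _ Pchi) le_chi.
  rewrite le_eqVlt => /predU1P[<-|]; last exact: le.
  have [phi Pphi] := Phi0; have [chi Pchi] := PhiZ _ _ x Pphi (lexx 0).
  by rewrite !mul0r; apply: le_trans; exact: inf_fun_le.
rewrite -lerBlDr; apply: le_inf_fun => phi Pphi.
rewrite lerBlDr -lerBlDl; apply: le_inf_fun => psi Ppsi.
have [chi Pchi le_chi] := PhiD _ _ x z Pphi Ppsi.
by rewrite lerBlDl; exact: le_trans (inf_fun_le _ Pchi) le_chi.
Qed.

End Infimum.

(** The functions [x |-> q (x + t y) - t q y] for [t >= 0]; their infimum is the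
    largest sublinear function below [q] that is at most [- q y] at [- y]. *)
Definition slope_family q (y : X) : set (X -> R) :=
  [set phi | exists2 t : R, 0 <= t & phi = fun x => q (x + t *: y) - t * q y].

Lemma slope_family_lower q y phi x : sublinear q -> slope_family q y phi ->
  - q (- x) <= phi x.
Proof.
move=> sq [t t0 ->].
have h : q (t *: y) <= q (x + t *: y) + q (- x).
  by apply: le_trans (sq.2 _ _); rewrite addrAC subrr add0r.
by move: h; rewrite sublinearZ//; lra.
Qed.

Lemma slope_family_neq0 q y : slope_family q y !=set0.
Proof. by eexists; exists 0. Qed.

Lemma slope_inf_le q y (t : R) x : sublinear q -> 0 <= t ->
  inf_fun (slope_family q y) x <= q (x + t *: y) - t * q y.
Proof.
move=> sq t0.
apply: (inf_fun_le (fun phi z => @slope_family_lower q y phi z sq)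
  (phi := fun z => q (z + t *: y) - t * q y)).
by exists t.
Qed.

Lemma slope_inf_sublinear q y : sublinear q ->
  sublinear (inf_fun (slope_family q y)).
Proof.
move=> sq; have [qZ qD] := sq.
apply: (@inf_fun_sublinear _ (fun x => - q (- x))).
- exact: slope_family_neq0.
- by move=> phi x; exact: slope_family_lower.
- move=> _ r x [t t0 ->] r0; eexists; first by exists (r * t); rewrite ?mulr_ge0.
  have h : q (r *: x + (r * t) *: y) <= r * q (x + t *: y).
    by apply: le_trans (qZ _ _ r0); rewrite scalerDr scalerA.
  by cbv beta; lra.
- move=> _ _ x z [t t0 ->] [s s0 ->].
  eexists; first by exists (t + s); rewrite ?addr_ge0.
  have h : q (x + z + (t + s) *: y) <= q (x + t *: y) + q (z + s *: y).
    by apply: le_trans (qD _ _); rewrite scalerDl addrACA.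
  by cbv beta; lra.
Qed.

(** A chain of sublinear functions below [p] is bounded below pointwise by
    [- p (- x)], so its infimum is a sublinear lower bound and Zorn's lemma
    applies. *)
Lemma minimal_sublinear p : sublinear p -> exists q,
  [/\ sublinear q, forall x, q x <= p x &
      forall q', sublinear q' -> (forall x, q' x <= q x) -> q' = q].
Proof.
move=> sp.
pose T := {q : X -> R | sublinear q /\ forall x, q x <= p x}.
pose below (s t : T) := `[< forall x, sval t x <= sval s x >].
have [] := @Zorn T below.
- by move=> t; apply/asboolP.
- move=> r s t /asboolP rs /asboolP st; apply/asboolP => x.
  exact: le_trans (st x) (rs x).
- move=> [s sP] [t tP] /asboolP st /asboolP ts; apply: eq_exist.
  by apply/funext => x; apply/le_anti; rewrite st ts.
- move=> A totA; have [->|/set0P[s0 As0]] := eqVneq A set0.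
    by exists (exist _ p (conj sp (fun x => lexx _))) => s.
  pose Phi := [set sval s | s in A].
  have Phi0 : Phi !=set0 by exists (sval s0), s0.
  have low phi x : Phi phi -> - p (- x) <= phi x.
    case=> -[q [sq qp]] _ <-; apply: le_trans (sublinear_lower x sq).
    by rewrite lerN2 qp.
  have sinf : sublinear (inf_fun Phi).
    apply: (inf_fun_sublinear Phi0 low) => [_ r x [s As <-] r0|].
      by exists (sval s); [exists s | exact: (svalP s).1.1].
    move=> _ _ x z [s As <-] [t At <-].
    have [/asboolP st|/asboolP ts] := totA _ _ As At.
      exists (sval t); first by exists t.
      by apply: le_trans ((svalP t).1.2 x z) _; rewrite lerD2r st.
    exists (sval s); first by exists s.
    by apply: le_trans ((svalP s).1.2 x z) _; rewrite lerD2l ts.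
  have le_inf s x : A s -> inf_fun Phi x <= sval s x.
    by move=> As; apply: (inf_fun_le low); exists s.
  have infp x : inf_fun Phi x <= p x.
    exact: le_trans (le_inf _ _ As0) ((svalP s0).2 x).
  exists (exist _ (inf_fun Phi) (conj sinf infp)) => s As.
  by apply/asboolP => x; exact: le_inf.
move=> [q [sq qp]] qmin; exists q; split=> // q' sq' q'q.
have q'p x : q' x <= p x by exact: le_trans (q'q x) (qp x).
have : `[< forall x, q' x <= q x >] by apply/asboolP.
by move=> /(qmin (exist _ q' (conj sq' q'p)))/(congr1 sval).
Qed.

(** The infimum of [slope_family q y] is sublinear and at most [q], so it equals
    [q]; the member for [t = 1] then gives [q x + q y <= q (x + y)]. *)
Lemma minimal_sublinear_scalar q : sublinear q ->
  (forall q', sublinear q' -> (forall x, q' x <= q x) -> q' = q) -> scalar q.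
Proof.
move=> sq qmin; have [_ qD] := sq.
have qDE x y : q (x + y) = q x + q y.
  apply/le_anti; rewrite qD/= -lerBrDr.
  have E : inf_fun (slope_family q y) = q.
    apply: qmin; first exact: slope_inf_sublinear.
    move=> z; have := slope_inf_le y z sq (lexx 0).
    by rewrite scale0r addr0 mul0r subr0.
  by have := slope_inf_le y x sq ler01; rewrite E scale1r mul1r.
have q0 : q 0 = 0 by have := qDE 0 0; rewrite addr0; lra.
have qN x : q (- x) = - q x by have := qDE x (- x); rewrite subrr q0; lra.
move=> r x y; rewrite qDE; congr (_ + _).
have [r0|r0] := leP 0 r; first exact: sublinearZ.
have := @sublinearZ q (- r) x sq.
rewrite scaleNr qN mulNr oppr_ge0 => /(_ (ltW r0)).
by move/oppr_inj.
Qed.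

(** A minimal sublinear function below the infimum of [slope_family p x0] is
    linear and at most [- p x0] at [- x0], hence at least [p x0] at [x0]. *)
Lemma hahn_banach p x0 : sublinear p ->
  exists f : X -> R, [/\ scalar f, forall x, f x <= p x & f x0 = p x0].
Proof.
move=> sp; have [q [sq qs qmin]] := minimal_sublinear (slope_inf_sublinear x0 sp).
have qp x : q x <= p x.
  apply: le_trans (qs x) _; have := slope_inf_le x0 x sp (lexx 0).
  by rewrite scale0r addr0 mul0r subr0.
exists q; split=> //; first exact: minimal_sublinear_scalar.
apply/le_anti; rewrite qp/=.
have := qs (- x0); have := slope_inf_le x0 (- x0) sp ler01.
rewrite scale1r addNr mul1r; have := sublinear_lower x0 sq.
have : p 0 <= 0 by have := sp.1 0 0 (lexx 0); rewrite scaler0 mul0r.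
lra.
Qed.

End HahnBanach.

(** * Weak compactness in the dual cone *)

Section Scalar.
Context {R : realType} {X : lmodType R}.
Implicit Types (f : X -> R) (x y : X) (r : R).

Lemma scalarD f x y : scalar f -> f (x + y) = f x + f y.
Proof. by move=> fs; have := fs 1 x y; rewrite scale1r mul1r. Qed.

Lemma scalar0 f : scalar f -> f 0 = 0.
Proof. by move=> fs; apply: (addrI (f 0)); rewrite -scalarD// !addr0. Qed.

Lemma scalar_scale f r x : scalar f -> f (r *: x) = r * f x.
Proof. by move=> fs; have := fs r x 0; rewrite scalar0// !addr0. Qed.

Lemma scalarN f x : scalar f -> f (- x) = - f x.
Proof. by move=> fs; rewrite -scaleN1r scalar_scale// mulN1r. Qed.

Lemma scalar_sum f (I : Type) (s : seq I) (F : I -> X) : scalar f ->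
  f (\sum_(i <- s) F i) = \sum_(i <- s) f (F i).
Proof.
move=> fs; elim: s => [|i s ih]; first by rewrite !big_nil scalar0.
by rewrite !big_cons scalarD// ih.
Qed.

End Scalar.

Lemma pos_part_continuous {R : realType} (T : topologicalType) (f : T -> R) :
  continuous f -> continuous (fun t => Num.max (f t) 0).
Proof.
move=> cf t; apply: (@continuous_max R T f (cst 0) t); first exact: cf.
exact: cst_continuous.
Qed.

(** For [u.1] in [0, 1] this is a convex combination. Clipping at [0] keeps the
    coefficients nonnegative on the whole line without losing continuity, so that
    they act on a cone for every [u.1]. *)
Lemma mix_continuous {R : realType} (T S : topologicalType)
    (f : T -> R) (g : S -> R) : continuous f -> continuous g ->
  continuous (fun u : R * (T * S) =>
    Num.max (1 - u.1) 0 * f u.2.1 + Num.max u.1 0 * g u.2.2).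
Proof.
move=> cf cg.
have c1 : continuous (fun u : R * (T * S) => u.1) by move=> u; exact: cvg_fst.
have c21 : continuous (fun u : R * (T * S) => f u.2.1).
  move=> u; apply: (continuous_comp (f := fun u : R * (T * S) => u.2.1)).
    by apply: (continuous_comp (f := snd)); [exact: cvg_snd|exact: cvg_fst].
  exact: cf.
have c22 : continuous (fun u : R * (T * S) => g u.2.2).
  move=> u; apply: (continuous_comp (f := fun u : R * (T * S) => u.2.2)).
    by apply: (continuous_comp (f := snd)); exact: cvg_snd.
  exact: cg.
have m1 : continuous (fun u : R * (T * S) => Num.max (1 - u.1) 0).
  apply: pos_part_continuous => u; apply: cvgB; first exact: cvg_cst.
  exact: c1.
have m2 := pos_part_continuous c1.
move=> u; apply: cvgD; apply: cvgM;
  [exact: m1|exact: c21|exact: m2|exact: c22].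
Qed.

Lemma sum_sqr_continuous {R : realType} (T : topologicalType) (I : Type)
    (s : seq I) (h : I -> T -> R) : (forall i, continuous (h i)) ->
  continuous (fun t => \sum_(i <- s) h i t ^+ 2).
Proof.
move=> ch; elim: s => [|i s ih].
  rewrite (_ : (fun _ => _) = cst 0); first exact: cst_continuous.
  by apply/funext => t; rewrite big_nil.
rewrite (_ : (fun _ => _) = fun t => h i t * h i t + \sum_(j <- s) h j t ^+ 2).
  by move=> t; apply: cvgD; [apply: cvgM; exact: ch|exact: ih].
by apply/funext => t; rewrite big_cons expr2.
Qed.

Lemma closed_linear_eq {R : realType} (T : topologicalType) (a b c : T -> R)
    (r : R) : continuous a -> continuous b -> continuous c ->
  closed [set t | a t = r * b t + c t].
Proof.
move=> ca cb cc.
have -> : [set t | a t = r * b t + c t] =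
    (fun t => a t - (r * b t + c t)) @^-1` [set 0].
  by apply/seteqP; split=> t /=; [move=> ->; rewrite subrr|move/subr0_eq].
apply: preimage_closed => [t _|]; last exact: closed_eq.
apply: cvgB; first exact: ca.
by apply: cvgD; [apply: cvgM; [exact: cvg_cst|exact: cb]|exact: cc].
Qed.

Section DualCone.
Context {R : realType} {X : lmodType R} {Y : lSemiModType (nnreal R)}.
Variable B : X -> Y -> R.
Hypothesis dB : asym_dual_pair B.
Implicit Types (K L : set Y) (x : X) (y z : Y).

Local Notation weak K := (K : set (dual_topology B)).

Lemma pair_comb x (s t : nnreal R) y z :
  B x (s *: y + t *: z) = val s * B x y + val t * B x z.
Proof. by rewrite (pair_addr dB) !(pair_scaler dB). Qed.

Lemma pair0r x : B x 0 = 0.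
Proof. by have := pair_scaler dB x 0 0; rewrite scale0r mul0r. Qed.

(** In the degenerate case [s + t = 0] both scalars vanish, and the equality is
    checked through the pairing, as are all equalities in the cone below: [Y]
    has no subtraction, but the pairing is nondegenerate. *)
Lemma cone_convex_comb K (s t : nnreal R) y z : cone_convex K -> K y -> K z ->
  exists2 w, K w & s *: y + t *: z = (s + t) *: w.
Proof.
move=> cK Ky Kz.
have st0 : 0 <= val s + val t := addr_ge0 (valP s) (valP t).
have [st|st] := eqVneq (val s + val t) 0.
  exists y => //; apply: (pair_nondegr dB) => x.
  move: st => /eqP; rewrite pair_comb (pair_scaler dB) /=.
  rewrite paddr_eq0; [|exact: (valP s)|exact: (valP t)].
  by move=> /andP[/eqP-> /eqP->]; rewrite addr0 !mul0r addr0.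
have nn (a : nnreal R) : val a / (val s + val t) \is Num.nneg.
  by rewrite nnegrE divr_ge0//; exact: (valP a).
exists (NNReal (nn s) *: y + NNReal (nn t) *: z).
  by apply: cK => //=; rewrite -mulrDl divff.
apply: (pair_nondegr dB) => x; rewrite (pair_scaler dB) !pair_comb/=.
by rewrite mulrDr !mulrA ![(_ + _) * val _]mulrC !mulfK.
Qed.

Lemma weak_continuous (T : topologicalType) (g : T -> Y) :
  (forall x, continuous (fun t => B x (g t) : R)) ->
  continuous (g : T -> dual_topology B).
Proof.
move=> cg; apply: continuous_comp_initial => t.
apply/cvg_sup => x; apply/cvg_image => //.
  by rewrite eqEsubset; split => v // _; exists (cst v).
move=> W /= /(cg x t) Wt; exists (@^~ x @^-1` W) => //.
by rewrite eqEsubset; split => [j [h + <-//]|j Wj]; exists (fun _ => j).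
Qed.

(** The segments joining a point of [K] to a point of [L] form the continuous
    image of the compact set [[0, 1] * K * L]. *)
Lemma convex_join K L : cone_convex K -> compact (weak K) -> K !=set0 ->
    cone_convex L -> compact (weak L) -> L !=set0 ->
  exists M, [/\ cone_convex M, compact (weak M), K `<=` M & L `<=` M].
Proof.
move=> vK cK [k0 Kk0] vL cL [l0 Ll0].
have nn (r : R) : Num.max r 0 \is Num.nneg by rewrite nnegrE le_max lexx orbT.
pose mix (u : R * (dual_topology B * dual_topology B)) : Y :=
  NNReal (nn (1 - u.1)) *: (u.2.1 : Y) + NNReal (nn u.1) *: (u.2.2 : Y).
have mixE x u : B x (mix u) =
    Num.max (1 - u.1) 0 * B x u.2.1 + Num.max u.1 0 * B x u.2.2.
  exact: pair_comb.
have mix01 x a k l : 0 <= a <= 1 ->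
    B x (mix (a, (k, l))) = (1 - a) * B x k + a * B x l.
  by move=> /andP[a0 a1]; rewrite mixE/= !max_l// subr_ge0.
exists (mix @` (`[0, 1]%classic `*` (weak K `*` weak L))); split.
- move=> s t ? ? st [[a [k l]] [/= a01 [Kk Ll]] <-].
  move=> [[b [k' l']] [/= b01 [Kk' Ll']] <-].
  have [s0 t0] : 0 <= val s /\ 0 <= val t by split; [exact: (valP s)|exact: (valP t)].
  rewrite !in_itv/= in a01 b01.
  have [a1 b1] : 0 <= 1 - a /\ 0 <= 1 - b.
    by rewrite !subr_ge0; case/andP: a01 => _ ->; case/andP: b01 => _ ->.
  have [a0 b0] : 0 <= a /\ 0 <= b by case/andP: a01 => ->; case/andP: b01 => ->.
  have [u Ku uE] := cone_convex_comb (s * NNReal (nn (1 - a)))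
    (t * NNReal (nn (1 - b))) vK Kk Kk'.
  have [v Lv vE] := cone_convex_comb (s * NNReal (nn a))
    (t * NNReal (nn b)) vL Ll Ll'.
  (* The weight that the combination puts on [L]. *)
  pose d := val s * a + val t * b.
  have d1 : 1 - d = val s * (1 - a) + val t * (1 - b).
    by rewrite /d; lra.
  have d01 : 0 <= d <= 1.
    by rewrite -[d <= 1]subr_ge0 d1 !addr_ge0// mulr_ge0.
  exists (d, (u, v)); first by split => //=; rewrite in_itv.
  apply: (pair_nondegr dB) => x; rewrite mix01// pair_comb !mix01//.
  have := congr1 (B x) uE; have := congr1 (B x) vE.
  rewrite !pair_comb !(pair_scaler dB)/= !max_l// -d1 -/d => <- <-.
  lra.
- apply: continuous_compact; last first.
    by apply: compact_setX; [exact: segment_compact|exact: compact_setX].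
  apply: continuous_subspaceT; apply: weak_continuous => x.
  rewrite (_ : (fun _ => _) = fun u => Num.max (1 - u.1) 0 * B x u.2.1 +
    Num.max u.1 0 * B x u.2.2); last by apply/funext => u; exact: mixE.
  exact: mix_continuous (@pair_continuous _ _ _ B x) (@pair_continuous _ _ _ B x).
- move=> k Kk; exists (0, (k, l0)).
    by split=> //=; rewrite in_itv/= lexx ler01.
  apply: (pair_nondegr dB) => x; rewrite mix01 ?lexx ?ler01//; lra.
- move=> l Ll; exists (1, (k0, l)).
    by split=> //=; rewrite in_itv/= lexx ler01.
  apply: (pair_nondegr dB) => x; rewrite mix01 ?lexx ?ler01//; lra.
Qed.

Lemma cone_convex1 y : cone_convex [set y].
Proof.
move=> s t _ _ st -> ->; apply: (pair_nondegr dB) => x.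
by rewrite pair_comb -mulrDl st mul1r.
Qed.

Lemma convex_hull_seq (Ks : seq (set Y)) :
    (forall K, K \in Ks -> cone_convex K /\ compact (weak K)) ->
  exists L, [/\ cone_convex L, compact (weak L), L 0 &
                forall K, K \in Ks -> K `<=` L].
Proof.
elim: Ks => [|K Ks ih] vcK.
  exists [set 0]; split=> //; first exact: cone_convex1.
  exact: compact_set1.
have [|L [vL cL L0 KsL]] := ih.
  by move=> K' K'Ks; apply: vcK; rewrite inE K'Ks orbT.
have [K0|/set0P Kn0] := eqVneq K set0.
  by exists L; split=> // K'; rewrite inE => /predU1P[->|/KsL//]; rewrite K0.
have [vK cK] := vcK K (mem_head _ _).
have [|M [vM cM KM LM]] := convex_join vK cK Kn0 vL cL; first by exists 0.
exists M; split=> //; first exact: LM.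
move=> K'; rewrite inE => /predU1P[->//|/KsL K'L].
exact: subset_trans K'L LM.
Qed.

(** Let [y0] in [L] minimise the squared distance of the vector
    [(B x y - f x)] indexed by [s] to the positive orthant, and let [c x] be the
    defects at [y0]. Minimality says that the functional with coefficients [c]
    is largest on [L] at [y0]. Testing the hypothesis at [\sum_x c x *: x] then
    gives [\sum_x c x ^+ 2 <= 0]. *)
Lemma finite_domination L f (s : seq X) : cone_convex L -> compact (weak L) ->
    scalar f -> (forall x, exists2 y, L y & f x <= B x y) ->
  exists2 y, L y & forall x, x \in s -> f x <= B x y.
Proof.
move=> vL cL fs fL.
pose g (y : dual_topology B) : R := \sum_(x <- s) Num.max (f x - B x y) 0 ^+ 2.
have cg : continuous g.
  apply: sum_sqr_continuous => x; apply: pos_part_continuous => y.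
  by apply: continuousB; [exact: cst_continuous|exact: pair_continuous].
have Ln0 : L !=set0 by have [y Ly _] := fL 0; exists y.
have [y0 /set_mem Ly0 gmin] :=
  @compact_EVT_min (dual_topology B) R g L Ln0 cL (continuous_subspaceT cg).
pose c x := Num.max (f x - B x y0) 0.
exists y0 => //.
(* First-order condition at the minimum, along the segment from y0 to y. *)
have var y : L y -> \sum_(x <- s) c x * (B x y - B x y0) <= 0.
  move=> Ly; rewrite leNgt; apply/negP.
  set S := \sum_(x <- s) _ => S0.
  pose D := \sum_(x <- s) (B x y - B x y0) ^+ 2.
  have D0 : 0 <= D by apply: sumr_ge0 => x _; exact: sqr_ge0.
  have SD : 0 < S + D by rewrite ltr_wpDr.
  (* Any t with 0 < t <= 1 and t * D < 2 * S would contradict minimality. *)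
  pose t := S / (S + D).
  have t0 : 0 < t by rewrite divr_gt0.
  have t1 : t <= 1 by rewrite ler_pdivrMr// mul1r lerDl.
  have nt : t \is Num.nneg by rewrite nnegrE ltW.
  have nt' : 1 - t \is Num.nneg by rewrite nnegrE subr_ge0.
  have Lyt : L (NNReal nt' *: y0 + NNReal nt *: y).
    by apply: vL => //=; rewrite subrK.
  have := gmin _ (mem_set Lyt).
  rewrite leNgt => /negP; apply.
  apply: (@le_lt_trans _ _ (\sum_(x <- s) (c x - t * (B x y - B x y0)) ^+ 2)).
    apply: ler_sum => x _; rewrite pair_comb/=.
    set d := B x y - B x y0.
    have cE : f x - ((1 - t) * B x y0 + t * B x y) <= c x - t * d.
      have : f x - B x y0 <= c x by rewrite /c le_max lexx.
      by rewrite /d; lra.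
    have [m0|m0] := leP 0 (f x - ((1 - t) * B x y0 + t * B x y)).
      by rewrite lerXn2r// nnegrE (le_trans m0).
    by rewrite expr0n/= sqr_ge0.
  have -> : \sum_(x <- s) (c x - t * (B x y - B x y0)) ^+ 2 =
      \sum_(x <- s) c x ^+ 2 - 2 * t * S + t ^+ 2 * D.
    rewrite /S /D !mulr_sumr -sumrB -big_split/=.
    by apply: eq_bigr => x _; lra.
  rewrite -[g y0]/(\sum_(x <- s) c x ^+ 2); set Q := \sum_(x <- s) _.
  suff : t * D < 2 * S.
    rewrite -(ltr_pM2l t0); lra.
  have : t * D <= S.
    rewrite /t mulrAC ler_pdivrMr// ler_wpM2l ?(ltW S0)//; lra.
  lra.
pose x0 := \sum_(x <- s) c x *: x.
have fx0E : f x0 = \sum_(x <- s) c x * f x.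
  by rewrite scalar_sum//; apply: eq_bigr => x _; rewrite scalar_scale.
have Bx0E y : B x0 y = \sum_(x <- s) c x * B x y.
  have Bs := pair_linearl dB y.
  rewrite (scalar_sum _ _ Bs); apply: eq_bigr => x _.
  exact: (scalar_scale _ _ Bs).
have [y Ly] := fL x0; rewrite fx0E Bx0E => fx0; have vary := var y Ly.
have cs : \sum_(x <- s) c x ^+ 2 <= 0.
  have -> : \sum_(x <- s) c x ^+ 2 = \sum_(x <- s) c x * f x -
      \sum_(x <- s) c x * B x y + \sum_(x <- s) c x * (B x y - B x y0).
    rewrite -sumrB -big_split/=; apply: eq_bigr => x _.
    rewrite -mulrBr -mulrDr addrA subrK /c.
    have [m0|m0] := leP 0 (f x - B x y0); first by rewrite expr2.
    by rewrite expr0n/= mul0r.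
  by move: fx0 vary; lra.
have c2 x : 0 <= c x ^+ 2 by exact: sqr_ge0.
move=> x xs; rewrite -subr_le0.
have : c x ^+ 2 <= 0.
  by apply: le_trans cs; rewrite (big_rem x)//= lerDl sumr_ge0.
have [//|m0] := leP (f x - B x y0) 0.
by rewrite /c max_l ?(ltW m0)// leNgt exprn_gt0.
Qed.

(** The weakly closed sets [[set y in L | f x <= B x y]] have the finite
    intersection property; a common point dominates [f] at [x] and at [- x],
    hence represents [f]. *)
Lemma dominated_representable L f : cone_convex L -> compact (weak L) ->
    scalar f -> (forall x, exists2 y, L y & f x <= B x y) ->
  exists2 y, L y & B^~ y = f.
Proof.
move=> vL cL fs fL.
pose above x : set (dual_topology B) := [set y | L y /\ f x <= B x y].
have finf : finI [set: X] above.
  move=> D _; have [y Ly yD] := finite_domination (finmap.enum_fset D) vL cL fs fL.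
  by exists y => x /= xD; split=> //; exact: yD.
have FF := finI_filter finf.
have [|y [Ly yF]] := cL _ FF.
  exists (above 0); first exact: finI_from1.
  by move=> y [].
exists y => //.
have le x : f x <= B x y.
  have cl : closed [set z : dual_topology B | f x <= B x z].
    apply: (@preimage_closed (dual_topology B) R (B x) [set r | f x <= r]).
      by move=> z _; exact: pair_continuous.
    exact: closed_ge.
  apply: cl => U yU; apply: yF yU.
  exists (above x); first exact: finI_from1.
  by move=> z [].
apply/funext => x; apply/le_anti; rewrite le andbT.
by have := le (- x); rewrite (scalarN _ fs) (scalarN _ (pair_linearl dB y)) lerN2.
Qed.

Definition polar (p : X -> R) : set Y := [set y | forall x, B x y <= p x].

Lemma polar_convex p : cone_convex (polar p).
Proof.
move=> s t y z st py pz x; rewrite pair_comb.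
rewrite -[p x]mul1r -st mulrDl lerD// ler_wpM2l//; [exact: (valP s)|exact: (valP t)].
Qed.

(** The linear functionals below [p] form a closed subset of the product of the
    segments [[- p (- x), p x]]. The hypothesis says that all of them come from
    [Y], so a cluster point in the product is one in [Y]. *)
Lemma polar_compact p :
    (forall f, scalar f -> (forall x, f x <= p x) -> exists y, B^~ y = f) ->
  compact (weak (polar p)).
Proof.
move=> pY.
pose ev : dual_topology B -> {ptws X -> R} := fun y => B^~ y.
pose lin : set {ptws X -> R} := [set f | scalar f].
pose box : set {ptws X -> R} := [set f | forall x, `[- p (- x), p x]%classic (f x)].
have cbox : compact box.
  apply: (@tychonoff X (fun=> R) (fun x => `[- p (- x), p x]%classic)) => x.
  exact: segment_compact.
have clin : closed lin.
  have -> : lin = \bigcap_(u in [set: R * X * X])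
      [set f : {ptws X -> R} |
        f (u.1.1 *: u.1.2 + u.2) = u.1.1 * f u.1.2 + f u.2].
    apply/seteqP; split=> [f fs [[r x] y] _ /=|f fs r x y].
      exact: fs.
    exact: (fs (r, x, y) I).
  apply: closed_bigI => -[[r x] y] _.
  have ce (z : X) : continuous (fun f : {ptws X -> R} => f z).
    exact: (@proj_continuous X (fun=> R)).
  exact: (closed_linear_eq (r := r) (ce _) (ce x) (ce y)).
have cQ : compact (box `&` lin) by exact: compact_closedI.
move=> F FF Fp.
have QF : (ev @ F) (box `&` lin).
  suff h : polar p `<=` ev @^-1` (box `&` lin) by exact: filterS h Fp.
  move=> y py; split; last exact: (pair_linearl dB).
  move=> x /=; rewrite in_itv/= py andbT lerNl.
  by rewrite -(scalarN _ (pair_linearl dB y)) py.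
have [f [[fbox flin] fF]] := cQ (ev @ F) _ QF.
have fp x : f x <= p x by have := fbox x; rewrite /= in_itv/= => /andP[].
have [y yf] := pY f flin fp.
exists y; split=> [x|A U FA [_ [[W oW <-]] /= Wy WU]]; first by move: (fp x); rewrite -yf.
have FA' : (ev @ F) (ev @` A).
  suff h : A `<=` ev @^-1` (ev @` A) by exact: filterS h FA.
  by move=> z Az; exists z.
have Wf : nbhs f W by rewrite -yf; exact: open_nbhs_nbhs.
have [_ [[z Az <-] Wz]] := fF _ _ FA' Wf.
by exists z; split=> //; exact: WU.
Qed.

End DualCone.

(** * The topology of a family of asymmetric seminorms *)

Section AsymmetricTopology.
Context {R : realType} {X : lmodType R}.
Implicit Types (P : set (asym_seminorm X)) (f : X -> R) (x z : X).

Lemma opens_asymP P (U : set X) : opens (asym_topology P) U <->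
  forall x, U x -> exists F (e : R),
    [/\ finite_set F, F `<=` P, 0 < e & asym_ball F x e `<=` U].
Proof.
split=> [[D DP <-] x [V DV Vx]|UP].
  have [F [t [e [finF FP e0 VE]]]] := DP _ DV.
  move: Vx; rewrite VE => Vx.
  have [d d0 dF] := asym_ball_inner finF e0 Vx.
  by exists F, d; split=> // z /dF tz; exists V => //; rewrite VE.
exists [set V | asym_basis P V /\ V `<=` U]; first by move=> V [].
apply/seteqP; split=> [x [V [_ VU] Vx]|x Ux]; first exact: VU.
have [F [e [finF FP e0 FU]]] := UP x Ux.
exists (asym_ball F x e); last exact: asym_ball_center.
by split=> //; exists F, x, e.
Qed.

Lemma opens_asym_mono P Q :
  P `<=` Q -> opens (asym_topology P) `<=` opens (asym_topology Q).
Proof.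
move=> PQ U /opens_asymP UP; apply/opens_asymP => x /UP[F [e [finF FP e0 FU]]].
by exists F, e; split=> //; exact: subset_trans FP PQ.
Qed.

Lemma asym_seminorm_sublinear (p : asym_seminorm X) : sublinear p.
Proof. by split=> [r x r0|x y]; [rewrite asn_hom|exact: asn_add]. Qed.

Lemma dominated_usc P (p : asym_seminorm X) f : P p -> scalar f ->
  (forall x, f x <= p x) -> upper_semicontinuous (asym_topology P) f.
Proof.
move=> Pp fs fp a; apply/opens_asymP => x /= fxa.
exists [set p], (a - f x); split.
- exact: finite_set1.
- by move=> _ ->.
- by rewrite subr_gt0.
- move=> z /(_ p erefl) pz; have := le_lt_trans (fp _) pz.
  by rewrite scalarD// scalarN//= ltrD2r.
Qed.

Lemma T0_of_usc (alpha : Topological X) (D : set (X -> R)) :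
    (forall f, D f -> upper_semicontinuous alpha f) ->
    (forall x z, (forall f, D f -> f x = f z) -> x = z) ->
  T0_topology alpha.
Proof.
move=> Du Dsep x z /eqP xz.
have [f [Df fxz]] : exists f, D f /\ f x != f z.
  apply: contrapT => h; apply: xz; apply: Dsep => f Df.
  by apply: contrapT => fxz; apply: h; exists f; split=> //; apply/eqP.
have nb t a : f t < a ->
    [set w | f w < a] \in nbhs (t : Topological.Pack alpha).
  by move=> fta; apply/mem_set/open_nbhs_nbhs; split=> //; exact: Du.
move: fxz; rewrite neq_lt => /orP[fxz|fzx].
  exists [set w | f w < f z]; left; split; first exact: nb.
  by apply/mem_set => /=; rewrite ltxx.
exists [set w | f w < f x]; right; split; first exact: nb.
by apply/mem_set => /=; rewrite ltxx.
Qed.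

End AsymmetricTopology.

(** * The Mackey topology *)

Section Mackey.
Context {R : realType} {X : lmodType R} {Y : lSemiModType (nnreal R)}.
Variable B : X -> Y -> R.
Hypothesis dB : asym_dual_pair B.
Implicit Types (x : X) (y : Y) (K L : set Y).

Local Notation weak K := (K : set (dual_topology B)).

Lemma le_support_function K x y : compact (weak K) -> K y ->
  B x y <= support_function B K x.
Proof.
move=> cK Ky; apply: (@le_trans _ _ (Num.max (B x y) 0)).
  by rewrite le_max lexx.
apply: ub_le_sup; last by exists y.
have [M KM] := pair_bounded x cK.
exists (Num.max M 0) => _ [z Kz <-].
by rewrite ge_max !le_max KM// lexx orbT.
Qed.

Lemma support_function_le K x (m : R) : 0 <= m ->
  (forall y, K y -> B x y <= m) -> support_function B K x <= m.
Proof.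
move=> m0 Km; rewrite /support_function.
have [->|/set0P[y0 Ky0]] := eqVneq K set0; first by rewrite image_set0 sup0.
apply: ge_sup; first by exists (Num.max (B x y0) 0), y0.
by move=> _ [y Ky <-]; rewrite ge_max Km.
Qed.

Lemma mackey_usc y : upper_semicontinuous (mackey_topology B) (B^~ y).
Proof.
have c1 : compact (weak [set y]) by exact: compact_set1.
have [p pE] := support_function_seminorm dB c1.
apply: (@dominated_usc _ _ _ p).
- by exists [set y]; split=> //; exact: (cone_convex1 dB).
- exact: pair_linearl.
- by move=> x; rewrite pE; exact: le_support_function.
Qed.

Lemma mackey_T0 : T0_topology (mackey_topology B).
Proof.
apply: (@T0_of_usc _ _ _ (range (fun y => B^~ y))) => [_ [y _ <-]|x z xz].
  exact: mackey_usc.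
apply/subr0_eq; apply: (pair_nondegl dB) => y.
have Bs := pair_linearl dB y.
rewrite (scalarD _ _ Bs) (scalarN _ Bs).
by have /= -> := xz _ (imageT _ y); rewrite subrr.
Qed.

(** The ball of radius [e] on which [f < 1] gives [e * f x <= max_L (B x)]: if
    not, [x / f x] would be in the ball, while [f] takes the value [1] there. *)
Lemma mackey_dual_representable f :
  dual_space (mackey_topology B) f -> range (fun y => B^~ y) f.
Proof.
move=> [fs fu].
have /opens_asymP/(_ 0) := fu 1.
case=> [/=|F [e [finF FM e0 Fball]]]; first by rewrite scalar0// ltr01.
have /choice[k kP] : forall p : asym_seminorm X, exists K, F p ->
    [/\ cone_convex K, compact (weak K) & p = support_function B K :> (X -> R)].
  move=> p; have [/FM[K KP]|nFp] := pselect (F p); first by exists K.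
  by exists set0.
have /finite_seqP[Ks KsE] : finite_set (k @` F) by exact: finite_image.
have [|L [vL cL L0 KsL]] := convex_hull_seq dB (Ks := Ks).
  move=> K KKs; have : (k @` F) K by rewrite KsE.
  by case=> p /kP[vK cK _] <-.
have pL p x y : F p -> L y -> (forall z, L z -> B x z <= B x y) -> p x <= B x y.
  move=> Fp Ly ymax; have [_ _ ->] := kP p Fp.
  apply: support_function_le; first by rewrite -(pair0r dB x) ymax.
  move=> z kz; apply: ymax; apply: KsL kz.
  by have : [set` Ks] (k p) by rewrite -KsE; exists p.
have efL x : exists2 y, L y & e * f x <= B x y.
  have [|y /set_mem Ly ymax] := @compact_EVT_max (dual_topology B) R (B x) L _ cL
    (continuous_subspaceT (@pair_continuous _ _ _ B x)); first by exists 0.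
  have {}ymax z : L z -> B x z <= B x y by move=> Lz; exact/ymax/mem_set.
  exists y => //; rewrite leNgt; apply/negP => yf.
  have y0 : 0 <= B x y by rewrite -(pair0r dB x) ymax.
  have fx0 : 0 < f x by rewrite -(pmulr_rgt0 _ e0); exact: le_lt_trans yf.
  have : f ((f x)^-1 *: x) < 1.
    apply: Fball => p Fp; rewrite subr0 asn_hom ?invr_ge0 ?(ltW fx0)//.
    rewrite ltr_pdivrMl// mulrC; apply: le_lt_trans yf; exact: pL.
  by rewrite scalar_scale// mulVf ?ltxx// gt_eqF.
have efs : scalar (fun x => e * f x) by move=> r x z; rewrite fs; lra.
have [y Ly yE] := dominated_representable dB vL cL efs efL.
have ne : e^-1 \is Num.nneg by rewrite nnegrE invr_ge0 ltW.
exists (NNReal ne *: y) => //; apply/funext => x.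
rewrite (pair_scaler dB)/=; have /(congr1 (@^~ x))/= -> := yE.
by rewrite mulKf// gt_eqF.
Qed.

Lemma mackey_has_dual : has_dual B (mackey_topology B).
Proof.
apply/seteqP; split=> [f|_ [y _ <-]]; first exact: mackey_dual_representable.
by split; [exact: pair_linearl|exact: mackey_usc].
Qed.

(** That [p] is at most the support function of its polar is the Hahn-Banach
    theorem: some linear functional below [p] agrees with [p] at [x]. *)
Lemma seminorm_support_polar (p : asym_seminorm X) :
    (forall f, scalar f -> (forall x, f x <= p x) -> exists y, B^~ y = f) ->
  p = support_function B (polar B p) :> (X -> R).
Proof.
move=> pY; apply/funext => x; apply/le_anti/andP; split; last first.
  by apply: support_function_le => [|y]; [exact: asn_ge0|exact].
have [f [fs fp <-]] := hahn_banach x (asym_seminorm_sublinear p).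
have [y yE] := pY f fs fp; rewrite -yE.
apply: le_support_function; first exact: polar_compact.
by move=> z; move: (fp z); rewrite -yE.
Qed.

(** The functionals below a seminorm of the family are upper semicontinuous for
    the topology it induces, so the hypothesis on the dual puts them in [Y]. *)
Lemma seminorm_mackey (P : set (asym_seminorm X)) (p : asym_seminorm X) :
  has_dual B (asym_topology P) -> P p -> mackey_seminorms B p.
Proof.
move=> dP Pp.
have pY f : scalar f -> (forall x, f x <= p x) -> exists y, B^~ y = f.
  move=> fs fp; have : dual_space (asym_topology P) f.
    by split=> //; exact: (dominated_usc Pp).
  by rewrite dP => -[y _ <-]; exists y.
exists (polar B p); split; [exact: polar_convex|exact: polar_compact|].
exact: seminorm_support_polar.
Qed.

End Mackey.

Theorem theorem3p11 (R : realType) (X : lmodType R)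
    (Y : lSemiModType (nnreal R)) (B : X -> Y -> R) :
  asym_dual_pair B ->
  finest
    [set alpha | [/\ T0_topology alpha, asym_locally_convex alpha
                   & has_dual B alpha]]
    (mackey_topology B).
Proof.
move=> dB; split.
  split; [exact: mackey_T0|by exists (mackey_seminorms B)|exact: mackey_has_dual].
move=> beta [_ [P betaE] dbeta]; rewrite betaE.
apply: opens_asym_mono => p; apply: (seminorm_mackey dB).
move: dbeta; rewrite /has_dual /dual_space /upper_semicontinuous.
by rewrite betaE.
Qed.
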